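(* Let $G,F_1,F_2,E$ be directed graphs and let $p_1,q_1:G\to F_1$, $p_2,q_2:G\to F_2$, $g_1,h_1:F_1\to E$, $g_2,h_2:F_2\to E$ be graph homomorphisms. These data form a three-dimensional textile system if and only if $T_t:=(G,F_1,p_1,q_1)$ and $T_b:=(F_2,E,g_2,h_2)$ are two-dimensional textile systems and $(p_2,g_1)$, $(q_2,h_1)$ are textile morphisms from $T_t$ to $T_b$ such that the maps $$s_{F_1}\times r_{F_1}\times g_1^1\times h_1^1:F_1^1\to F_1^0\times F_1^0\times E^1\times E^1,$$ $$p_1^0\times q_1^0\times p_2^0\times q_2^0:G^0\to F_1^0\times F_1^0\times F_2^0\times F_2^0$$ are injective.
   Context: A directed graph is written $E=(E^0,E^1,r_E,s_E)$ (vertices, edges, range, source). A graph homomorphism $f=(f^0,f^1)$ consists of a vertex map and an edge map commuting with ranges and sources. For maps $a_i:X\to Y_i$, $a_1\times\cdots\times a_m$ denotes $x\mapsto(a_1(x),\dots,a_m(x))$. A (two-dimensional) textile system is $T=(F,E,p,q)$ with $p,q:F\to E$ graph homomorphisms such that $s_F\times r_F\times p^1\times q^1$ is injective on $F^1$. A textile morphism from $(F,E,p,q)$ to $(F',E',p',q')$ is a pair $(\phi_F,\phi_E)$ of graph homomorphisms $\phi_F:F\to F'$, $\phi_E:E\to E'$ with $p'\circ\phi_F=\phi_E\circ p$ and $q'\circ\phi_F=\phi_E\circ q$. Data $(G,F_1,F_2,E;p_1,q_1,p_2,q_2,g_1,h_1,g_2,h_2)$ as in the claim form a three-dimensional textile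 system if ($\mathcal C$) $g_1p_1=g_2p_2$, $h_1q_1=h_2q_2$, $g_1q_1=h_2p_2$, $h_1p_1=g_2q_2$; and ($\mathcal I$) the following maps are injective: $s_G\times r_G\times p_1^1\times q_1^1\times p_2^1\times q_2^1$ on $G^1$; $p_1^0\times q_1^0\times p_2^0\times q_2^0$ on $G^0$; $s_{F_1}\times r_{F_1}\times g_1^1\times h_1^1$ on $F_1^1$; $s_{F_2}\times r_{F_2}\times g_2^1\times h_2^1$ on $F_2^1$. *)

(* Defs.v *)
From mathcomp Require Import all_boot.
From Stdlib Require Import FunctionalExtensionality ProofIrrelevance.

Set Implicit Arguments.
Unset Strict Implicit.
Unset Printing Implicit Defensive.

Record digraph : Type := Digraph {
  vertex : Type;
  edge : Type;
  range : edge -> vertex;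
  source : edge -> vertex
}.

Record ghom (A B : digraph) : Type := GHom {
  vmap : vertex A -> vertex B;
  emap : edge A -> edge B;
  range_emap : forall e, range (emap e) = vmap (range e);
  source_emap : forall e, source (emap e) = vmap (source e)
}.

(* Equality of homomorphisms is equality of the underlying vertex and edge
   maps; the commutation proofs play no role. *)
Lemma ghom_ext (A B : digraph) (f g : ghom A B) :
  vmap f =1 vmap g -> emap f =1 emap g -> f = g.
Proof.
case: f g => [f0 f1 fr fs] [g0 g1 gr gs] /= /functional_extensionality f0g0.
move=> /functional_extensionality f1g1; subst g0 g1.
by rewrite (proof_irrelevance _ gr fr) (proof_irrelevance _ gs fs).
Qed.

Lemma gcomp_range (A B C : digraph) (g : ghom B C) (f : ghom A B) e :
  range (emap g (emap f e)) = vmap g (vmap f (range e)).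
Proof. by rewrite !range_emap. Qed.

Lemma gcomp_source (A B C : digraph) (g : ghom B C) (f : ghom A B) e :
  source (emap g (emap f e)) = vmap g (vmap f (source e)).
Proof. by rewrite !source_emap. Qed.

Definition gcomp (A B C : digraph) (g : ghom B C) (f : ghom A B) : ghom A C :=
  @GHom A C (fun v => vmap g (vmap f v)) (fun e => emap g (emap f e))
    (gcomp_range g f) (gcomp_source g f).

Notation "g \oh f" := (gcomp g f) (at level 50, left associativity).

Definition textile_system (F E : digraph) (p q : ghom F E) : Prop :=
  injective (fun e : edge F => (source e, range e, emap p e, emap q e)).

(* Pairs (phiF, phiE) from (F, E, p, q) to (F', E', p', q'). *)
Definition textile_morphism (F E F' E' : digraph) (p q : ghom F E)
    (p' q' : ghom F' E') (phiF : ghom F F') (phiE : ghom E E') : Prop :=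
  p' \oh phiF = phiE \oh p /\ q' \oh phiF = phiE \oh q.

Definition textile_system3 (G F1 F2 E : digraph) (p1 q1 : ghom G F1)
    (p2 q2 : ghom G F2) (g1 h1 : ghom F1 E) (g2 h2 : ghom F2 E) : Prop :=
  [/\ g1 \oh p1 = g2 \oh p2, h1 \oh q1 = h2 \oh q2,
      g1 \oh q1 = h2 \oh p2 & h1 \oh p1 = g2 \oh q2] /\
  [/\ injective (fun e : edge G =>
        (source e, range e, emap p1 e, emap q1 e, emap p2 e, emap q2 e)),
      injective (fun v : vertex G =>
        (vmap p1 v, vmap q1 v, vmap p2 v, vmap q2 v)),
      injective (fun e : edge F1 => (source e, range e, emap g1 e, emap h1 e))
    & injective (fun e : edge F2 => (source e, range e, emap g2 e, emap h2 e))].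

(* Main.v *)
(** On edges of [G], the maps [p2] and [q2] are already determined by source,
    range, [p1] and [q1]: by the commutation relations the source, range and
    images under [g2] and [h2] of [p2 e] are functions of those of [e], and
    [(F2, E, g2, h2)] is a textile system (likewise for [q2]).  So the
    injectivity on edges of [G] for the three-dimensional system is equivalent
    to that for [(G, F1, p1, q1)]. *)
Require Import Defs.
From mathcomp Require Import all_boot.

Set Implicit Arguments.
Unset Strict Implicit.
Unset Printing Implicit Defensive.

Lemma gcomp_emap (A B B' C : digraph) (g : ghom B C) (f : ghom A B)
    (g' : ghom B' C) (f' : ghom A B') :
  g \oh f = g' \oh f' -> forall e, emap g (emap f e) = emap g' (emap f' e).
Proof. by move=> gf e; exact: (congr1 (fun k => emap k e) gf). Qed.

(** The edges [emap phiF e1] and [emap phiF e2] share source, range and, by the morphism equations,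
    images under [p'] and [q']; these data separate the edges of [F']. *)
Lemma textile_morphism_emap (F E F' E' : digraph) (p q : ghom F E)
    (p' q' : ghom F' E') (phiF : ghom F F') (phiE : ghom E E') :
  textile_system p' q' -> textile_morphism p q p' q' phiF phiE ->
  forall e1 e2, source e1 = source e2 -> range e1 = range e2 ->
  emap p e1 = emap p e2 -> emap q e1 = emap q e2 ->
  emap phiF e1 = emap phiF e2.
Proof.
move=> injT [/gcomp_emap cp /gcomp_emap cq] e1 e2 es er ep eq.
by apply: injT; rewrite /= !source_emap !range_emap !cp !cq es er ep eq.
Qed.

Theorem theorem6p5 (G F1 F2 E : digraph) (p1 q1 : ghom G F1)
    (p2 q2 : ghom G F2) (g1 h1 : ghom F1 E) (g2 h2 : ghom F2 E) :
  textile_system3 p1 q1 p2 q2 g1 h1 g2 h2 <->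
  (textile_system p1 q1 /\ textile_system g2 h2) /\
  (textile_morphism p1 q1 g2 h2 p2 g1 /\ textile_morphism p1 q1 g2 h2 q2 h1) /\
  injective (fun e : edge F1 => (source e, range e, emap g1 e, emap h1 e)) /\
  injective (fun v : vertex G => (vmap p1 v, vmap q1 v, vmap p2 v, vmap q2 v)).
Proof.
split=> [[[c1 c2 c3 c4] [injG1 injG0 injF1 injF2]]|].
  (* Up to symmetry, [c1] and [c3] are the morphism equations for [(p2, g1)], [c4] and [c2] those
     for [(q2, h1)]. *)
  have mp : textile_morphism p1 q1 g2 h2 p2 g1 by split.
  have mq : textile_morphism p1 q1 g2 h2 q2 h1 by split.
  do !split=> //; move=> e1 e2 [es er ep eq]; apply: injG1 => /=.
  by rewrite es er ep eq (textile_morphism_emap injF2 mp es er ep eq)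
    (textile_morphism_emap injF2 mq es er ep eq).
case=> [[injT injB] [[[c1 c3] [c4 c2]] [injF1 injG0]]].
(* The six coordinates on edges of [G] include the four that [injT] separates. *)
split; split=> // e1 e2 [es er ep eq _ _].
by apply: injT; rewrite /= es er ep eq.
Qed.
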